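(* Each fibred action of an inverse category $\mathcal{C}$ on a poset $P$ determines an action of $\mathcal{C}$ via symmetries on $P$.
   Context: An inverse category is a category $\mathcal{C}$ in which for every arrow $s:X\to Y$ there is a unique arrow $s^\circ:Y\to X$ with $ss^\circ s=s$ and $s^\circ ss^\circ=s^\circ$. The composite $st$ means first $t$, then $s$. $\mathcal{C}$ also denotes its class of arrows and $\mathcal{C}^{(0)}$ its class of objects. For $s:X\to Y$ put $od(s)=X$, $or(s)=Y$, $id(s)=s^\circ s$, $ir(s)=ss^\circ$. $E(\mathcal{C})$ is the set of idempotent arrows. The natural order: for parallel arrows $s,t:X\to Y$, $s\leqslant t$ iff $s=te$ for some idempotent $e:X\to X$. A fibred (ordered) action of $\mathcal{C}$ on a poset $(P,\leqslant)$ is a pair $(\rho,\theta)$ such that: - $\rho:P\to\mathcal{C}^{(0)}\times E(\mathcal{C})$, $\rho(x)=(o\rho(x),i\rho(x))$ (the moment map), satisfies $od(i\rho(x))=o\rho(x)$, and $i\rho$ is order preserving; - $\theta:\mathcal{C}\,{}_d\times_\rho P\to P$, $(s,x)\mapsto\theta_s(x)$ (the action map), where $\mathcal{C}\,{}_d\times_\rho P=\{(s,x)\in\mathcal{C}\times P: o\rho(x)=od(s),\ i\rho(x)\leqslant id(s)\}$, and for each $s\in\mathcal{C}$ the map $\theta_s:\{x\in P:(s,x)\in\mathcal{C}\,{}_d\times_\rho P\}\to P$, $x\mapsto\theta_s(x)$, is order preserving; - for every $x\in P$ and $s,t\in\mathcal{C}$: (I) $\theta_{i\rho(x)}(x)=x$;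 (II) $o\rho(\theta_s(x))=or(s)$, $i\rho(\theta_s(x))\leqslant ir(s)$, and $i\rho(\theta_s(x))=ir(s)$ if $id(s)=i\rho(x)$; (III) $\theta_s(\theta_t(x))=\theta_{st}(x)$ if $(t,x)\in\mathcal{C}\,{}_d\times_\rho P$ and the composition $st$ is defined in $\mathcal{C}$. Write $I\triangleleft P$ when $I$ is an order ideal (down-closed subset) of $P$; the empty set is included as an ideal. The inverse category $\mathcal{I}_{ic}(P)$ has as objects the ideals of $P$; a morphism from $U$ to $V$ is an order preserving bijection $s:U'\to V'$ with $U'\triangleleft U$ and $V'\triangleleft V$; the composite of $s:U'\to V'$ (from $U$ to $V$) and $t:V''\to W'$ (from $V$ to $W$) is $ts=t_{|V'\cap V''}\circ s_{|s^{-1}(V'\cap V'')}:s^{-1}(V'\cap V'')\to t(V'\cap V'')$; the inverse structure is the inversion of maps. An action of $\mathcal{C}$ via symmetries on $P$ is a functor $\Theta:\mathcal{C}\to\mathcal{I}_{ic}(P)$ such that $P=\bigcup_{X\in\mathcal{C}^{(0)}}\Theta(X)$. *)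

(* Defs.v *)
From HB Require Import structures.
From mathcomp Require Import all_boot all_order.
From mathcomp Require Import boolp classical_sets.

Set Implicit Arguments.
Unset Strict Implicit.
Unset Printing Implicit Defensive.

Import Order.TTheory.
Local Open Scope order_scope.
Local Open Scope classical_set_scope.

Declare Scope icat_scope.
Delimit Scope icat_scope with IC.
Local Open Scope icat_scope.

Reserved Notation "s ∘ t" (at level 40, left associativity).

(* [s ∘ t] is: first [t], then [s]. *)
Record category := Category {
  obj :> Type;
  hom : obj -> obj -> Type;
  idc : forall X, hom X X;
  ccomp : forall X Y Z, hom Y Z -> hom X Y -> hom X Z;
  ccomp1s : forall X Y (s : hom X Y), ccomp (idc Y) s = s;
  ccomps1 : forall X Y (s : hom X Y), ccomp s (idc X) = s;
  ccompA : forall X Y Z W (s : hom Z W) (t : hom Y Z) (u : hom X Y),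
    ccomp s (ccomp t u) = ccomp (ccomp s t) u
}.

Arguments idc {c} X.
Arguments ccomp {c X Y Z} s t.
Notation "s ∘ t" := (ccomp s t) : icat_scope.

Record functor (C D : category) := Functor {
  fobj :> C -> D;
  fhom : forall X Y : C, hom X Y -> hom (fobj X) (fobj Y);
  fhom1 : forall X, fhom (idc X) = idc (fobj X);
  fhomM : forall (X Y Z : C) (s : hom Y Z) (t : hom X Y),
    fhom (s ∘ t) = fhom s ∘ fhom t
}.

Arguments fhom {C D} f {X Y} s.

Definition inverse_pair (C : category) (X Y : C) (s : hom X Y) (t : hom Y X) :=
  s ∘ t ∘ s = s /\ t ∘ s ∘ t = t.

Record inverse_category := InverseCategory {
  icat :> category;
  cinv : forall X Y : icat, hom X Y -> hom Y X;
  cinvP : forall (X Y : icat) (s : hom X Y), inverse_pair s (cinv s);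
  cinv_uniq : forall (X Y : icat) (s : hom X Y) (t : hom Y X),
    inverse_pair s t -> t = cinv s
}.

Arguments cinv {i X Y} s.

Definition idempotent_endo (C : category) (X : C) (e : hom X X) := e ∘ e = e.

Definition nat_le (C : category) (X Y : C) (s t : hom X Y) :=
  exists2 e : hom X X, idempotent_endo e & s = t ∘ e.

(* The class of all arrows, with source and target forgotten by the type, so
   that arrows with unrelated sources and targets can be compared. *)
Record arrow (C : category) := Arrow {
  src : C;
  tgt : C;
  arr : hom src tgt
}.

Arguments Arrow {C src tgt} arr.

Definition idempotent_arrow (C : category) (a : arrow C) :=
  exists (X : C) (e : hom X X), idempotent_endo e /\ a = Arrow e.

(* Only parallel arrows are comparable. *)
Definition arrow_le (C : category) (a b : arrow C) :=
  exists (X Y : C) (s t : hom X Y), [/\ nat_le s t, a = Arrow s & b = Arrow t].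

Definition id_arr (C : inverse_category) (a : arrow C) : arrow C :=
  Arrow (cinv (arr a) ∘ arr a).

Definition ir_arr (C : inverse_category) (a : arrow C) : arrow C :=
  Arrow (arr a ∘ cinv (arr a)).

Definition act_dom (C : inverse_category) (P : Type)
    (moment : P -> C * arrow C) (s : arrow C) (x : P) :=
  (moment x).1 = src s /\ arrow_le (moment x).2 (id_arr s).

(* In [action_comp] both sides of the equation are required to be defined.  The
   stronger readings, in which definedness of one side is part of the axiom,
   imply this one. *)
Record fibred_action (C : inverse_category) d (P : porderType d) :=
    FibredAction {
  moment : P -> C * arrow C;
  moment_idem : forall x, idempotent_arrow (moment x).2;
  moment_src : forall x, src (moment x).2 = (moment x).1;
  moment_homo : forall x y, x <= y -> arrow_le (moment x).2 (moment y).2;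
  action_map : forall s x, act_dom moment s x -> P;
  action_homo : forall s x y (hx : act_dom moment s x) (hy : act_dom moment s y),
    x <= y -> action_map hx <= action_map hy;
  action_id : forall x (h : act_dom moment (moment x).2 x), action_map h = x;
  action_moment : forall s x (h : act_dom moment s x),
    [/\ (moment (action_map h)).1 = tgt s,
        arrow_le (moment (action_map h)).2 (ir_arr s)
      & id_arr s = (moment x).2 -> (moment (action_map h)).2 = ir_arr s];
  action_comp : forall (X Y Z : C) (s : hom Y Z) (t : hom X Y) x
      (ht : act_dom moment (Arrow t) x)
      (hs : act_dom moment (Arrow s) (action_map ht))
      (hst : act_dom moment (Arrow (s ∘ t)) x),
    action_map hs = action_map hst
}.

Arguments action_map {C d P} f {s x} _.

Section IdempotentInverse.
Variable C : inverse_category.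

Lemma cinv_idem (X : C) (e : hom X X) : idempotent_endo e -> cinv e = e.
Proof. by move=> ee; apply/esym/cinv_uniq; split; rewrite ee. Qed.

(* The side condition of [action_id] always holds. *)
Lemma act_dom_moment d (P : porderType d) (A : fibred_action C P) (x : P) :
  act_dom (moment A) (moment A x).2 x.
Proof.
split; first by rewrite moment_src.
have [X [e [ee ->]]] := moment_idem A x.
by exists X, X, e, e; split=> //; [exists e; rewrite ?ee |
  rewrite /id_arr /= cinv_idem // ee].
Qed.

End IdempotentInverse.

Section PartialSymmetries.
Variables (d : Order.disp_t) (P : porderType d).

Definition is_ideal (A : set P) := forall x y, x <= y -> A y -> A x.

Record ideal := Ideal {
  ideal_set :> set P;
  ideal_down : is_ideal ideal_set
}.

Definition pdom (f : P -> option P) : set P :=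
  [set x | exists y, f x = Some y].

Definition pimg (f : P -> option P) : set P :=
  [set y | exists x, f x = Some y].

(* The order preserving bijection is that from [pdom pfun] onto [pimg pfun].
   Its inverse is required to be order preserving too, as the inverse structure
   is the inversion of maps; images of ideals need not be ideals otherwise. *)
Record psym (U V : ideal) := PSym {
  pfun :> P -> option P;
  pdom_ideal : is_ideal (pdom pfun);
  pdom_sub : pdom pfun `<=` U;
  pimg_ideal : is_ideal (pimg pfun);
  pimg_sub : pimg pfun `<=` V;
  psym_inj : forall x x' y, pfun x = Some y -> pfun x' = Some y -> x = x';
  psym_mono : forall x x' y y', pfun x = Some y -> pfun x' = Some y' ->
    (x <= x') = (y <= y')
}.

Lemma psymP (U V : ideal) (s t : psym U V) : pfun s = pfun t -> s = t.
Proof.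
case: s t => [f a b c g i m] [f' a' b' c' g' i' m'] /= eqf.
by case: _ / eqf in a' b' c' g' i' m' *; congr PSym; apply: Prop_irrelevance.
Qed.

Definition psym1_fun (U : ideal) (x : P) : option P :=
  if asbool (ideal_set U x) then Some x else None.

Lemma psym1_funE U x y : psym1_fun U x = Some y <-> ideal_set U x /\ x = y.
Proof.
rewrite /psym1_fun; case: asboolP => Ux; split=> //.
- by move=> [<-].
- by move=> [_ ->].
- by case.
Qed.

Lemma pdom_psym1 U : pdom (psym1_fun U) = U.
Proof.
apply/seteqP; split=> x /=; first by move=> [y /psym1_funE[]].
by move=> Ux; exists x; apply/psym1_funE.
Qed.

Lemma pimg_psym1 U : pimg (psym1_fun U) = U.
Proof.
apply/seteqP; split=> x /=; first by move=> [y /psym1_funE[? <-]].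
by move=> Ux; exists x; apply/psym1_funE.
Qed.

Definition psym1 (U : ideal) : psym U U.
Proof.
apply: (@PSym U U (psym1_fun U)); rewrite ?pdom_psym1 ?pimg_psym1 //.
- exact: ideal_down.
- exact: ideal_down.
- by move=> x x' y /psym1_funE[_ ->] /psym1_funE[_ ->].
- by move=> x x' y y' /psym1_funE[_ ->] /psym1_funE[_ ->].
Defined.

Definition pcomp_fun (g f : P -> option P) (x : P) : option P :=
  obind g (f x).

Lemma pcomp_funE g f x z :
  pcomp_fun g f x = Some z <-> exists2 y, f x = Some y & g y = Some z.
Proof.
rewrite /pcomp_fun; split; first by case: (f x) => //= y gy; exists y.
by move=> [y -> /= ->].
Qed.

Definition psym_comp (U V W : ideal) (t : psym V W) (s : psym U V) : psym U W.
Proof.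
apply: (@PSym U W (pcomp_fun t s)).
- move=> x x' xx' [z' /pcomp_funE[y' sx' ty']].
  have [y sx] : pdom s x by apply: pdom_ideal xx' _; exists y'.
  have yy' : y <= y' by rewrite -(psym_mono sx sx').
  have [z ty] : pdom t y by apply: pdom_ideal yy' _; exists z'.
  by exists z; apply/pcomp_funE; exists y.
- by move=> x [z /pcomp_funE[y sx _]]; apply: (pdom_sub (p := s)); exists y.
- move=> z z' zz' [x' /pcomp_funE[y' sx' ty']].
  have [y ty] : pimg t z by apply: pimg_ideal zz' _; exists y'.
  have yy' : y <= y' by rewrite (psym_mono ty ty').
  have [x sx] : pimg s y by apply: pimg_ideal yy' _; exists x'.
  by exists x; apply/pcomp_funE; exists y.
- by move=> z [x /pcomp_funE[y _ ty]]; apply: (pimg_sub (p := t)); exists y.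
- move=> x x' z /pcomp_funE[y sx ty] /pcomp_funE[y' sx' ty'].
  by move: (psym_inj ty ty') sx => -> sx; apply: psym_inj sx sx'.
- move=> x x' z z' /pcomp_funE[y sx ty] /pcomp_funE[y' sx' ty'].
  by rewrite (psym_mono sx sx') (psym_mono ty ty').
Defined.

Lemma psym_comp1c U V (s : psym U V) : psym_comp (psym1 V) s = s.
Proof.
apply/psymP/funext => x /=; rewrite /pcomp_fun.
case sx: (s x) => [y|] //=; apply/psym1_funE; split=> //.
by apply: (pimg_sub (p := s)); exists x.
Qed.

Lemma psym_compc1 U V (s : psym U V) : psym_comp s (psym1 U) = s.
Proof.
apply/psymP/funext => x /=; rewrite /pcomp_fun /psym1_fun.
case: asboolP => //= nUx; case sx: (s x) => [y|] //.
by case: nUx; apply: (pdom_sub (p := s)); exists y.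
Qed.

Lemma psym_compA U V W Z (s : psym W Z) (t : psym V W) (u : psym U V) :
  psym_comp s (psym_comp t u) = psym_comp (psym_comp s t) u.
Proof. by apply/psymP/funext => x /=; rewrite /pcomp_fun; case: (u x). Qed.

Definition Iic_category : category :=
  @Category ideal psym psym1 psym_comp psym_comp1c psym_compc1 psym_compA.

Definition pinv_fun (f : P -> option P) (y : P) : option P :=
  if pselect (exists x, f x = Some y) is left fy then Some (sval (cid fy))
  else None.

Lemma pinv_funE U V (s : psym U V) x y :
  pinv_fun s y = Some x <-> s x = Some y.
Proof.
rewrite /pinv_fun; case: pselect => [sy|nsy].
  case: cid => x' /= sx'; split=> [[<-]//|sx].
  by rewrite (psym_inj sx' sx).
by split=> // sx; case: nsy; exists x.
Qed.

Lemma pdom_pinv U V (s : psym U V) : pdom (pinv_fun s) = pimg s.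
Proof. by apply/seteqP; split=> y [x /pinv_funE sx]; exists x. Qed.

Lemma pimg_pinv U V (s : psym U V) : pimg (pinv_fun s) = pdom s.
Proof. by apply/seteqP; split=> x [y /pinv_funE sx]; exists y. Qed.

Definition psym_inv (U V : ideal) (s : psym U V) : psym V U.
Proof.
apply: (@PSym V U (pinv_fun s)); rewrite ?pdom_pinv ?pimg_pinv.
- exact: pimg_ideal.
- exact: pimg_sub.
- exact: pdom_ideal.
- exact: pdom_sub.
- by move=> y y' x /pinv_funE sx /pinv_funE; rewrite sx => -[].
- by move=> y y' x x' /pinv_funE sx /pinv_funE sx'; rewrite (psym_mono sx sx').
Defined.

Lemma psym_invP (U V : Iic_category) (s : hom U V) :
  inverse_pair s (psym_inv s : hom V U).
Proof.
split; apply/psymP/funext => x; rewrite /= /pcomp_fun /=.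
  case sx: (pfun s x) => [y|] //=.
  by move/pinv_funE: (sx) => -> /=.
case sx: (pinv_fun s x) => [y|] //=.
by move/pinv_funE: (sx) => -> /=.
Qed.

Lemma psym_inv_uniq (U V : Iic_category) (s : hom U V) (t : hom V U) :
  inverse_pair s t -> t = psym_inv s.
Proof.
move=> [sts tst]; apply/psymP/funext => y.
have ts x : pfun t y = Some x -> pfun s x = Some y.
  move=> ty; have: pfun (t ∘ s ∘ t) y = Some x by rewrite tst.
  case/pcomp_funE=> x'; rewrite ty => -[<-] /pcomp_funE[y' sx ty'].
  by rewrite (psym_inj ty ty').
have st x : pfun s x = Some y -> pfun t y = Some x.
  move=> sx; have: pfun (s ∘ t ∘ s) x = Some y by rewrite sts.
  case/pcomp_funE=> y'; rewrite sx => -[<-] /pcomp_funE[x' ty sx'].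
  by rewrite (psym_inj sx sx').
case ty: (pfun t y) => [x|]; first by apply/esym/pinv_funE/ts.
case sy: (pfun (psym_inv s) y) => [x|] //.
by move/pinv_funE: sy => /st; rewrite ty.
Qed.

Definition Iic : inverse_category :=
  @InverseCategory Iic_category psym_inv psym_invP psym_inv_uniq.

End PartialSymmetries.

Record sym_action (C : inverse_category) d (P : porderType d) := SymAction {
  sym_functor :> functor C (Iic P);
  sym_cover : \bigcup_(X in setT) (sym_functor X : set P) = setT
}.

(* This fixes [Theta] completely: the ideal [Theta X] is the fibre of the object
   part of the moment map over [X], and the partial map [Theta s] is
   [x |-> theta_s(x)], defined exactly where the action map is. *)
Definition determines (C : inverse_category) d (P : porderType d)
    (A : fibred_action C P) (Theta : sym_action C P) :=
  (forall X : C, (Theta X : set P) = [set x | (moment A x).1 = X]) /\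
  (forall (X Y : C) (s : hom X Y) (x y : P),
     pfun (fhom Theta s) x = Some y <->
     exists h : act_dom (moment A) (Arrow s) x, action_map A h = y).

(* Main.v *)
Require Import Defs.
From mathcomp Require Import all_boot all_order.
From mathcomp Require Import boolp classical_sets.

(** Write [e] for the idempotent [iρ(x)].  A point [x] of the fibre over [X]
    lies in the domain of [θ_s], for [s : X -> Y], exactly when [s°s e = e].
    This one equation drives the proof.

    - As [iρ] is monotone, going down from [x] replaces [e] by some [e f], and
      the equation survives: domains, like fibres, are ideals.
    - [θ_s] fixes every [x] in its domain when [s] is idempotent: [s e = e]
      then, so that [θ_s(x) = θ_s(θ_e(x)) = θ_{s e}(x) = θ_e(x) = x]
      ([action_map_idem]).  Hence [θ_{s°}] and [θ_s] are mutually inverse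
      between the domains of [s] and of [s°]; so the image of [θ_s], being the
      domain of [θ_{s°}], is an ideal too, and both maps are monotone
      ([action_map_cinvK], [act_dom_cinvP]).
    - The moment map is equivariant: [iρ(θ_s(x)) = s e s°]
      ([moment_action_map]).  Indeed [θ_s(x) = θ_{s e}(x)], and
      [id(s e) = e = iρ(x)], so that the exact form of axiom (II) applies to
      the arrow [s e].

    Functoriality on composites requires the domain of [θ_{s t}] to be the set
    of [x] in the domain of [θ_t] with [θ_t(x)] in the domain of [θ_s]
    ([act_dom_comp]); the axioms give the values on this set.  By equivariance
    the claim becomes the equivalence of [t°s°s t e = e] with the conjunction
    of [t°t e = e] and [s°s (t e t°) = t e t°], which is a computation with
    commuting idempotents. *)

Import Order.TTheory.
Local Open Scope order_scope.
Local Open Scope classical_set_scope.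
Local Open Scope icat_scope.

(** * Idempotents in an inverse category *)

Section InverseCategory.
Set Implicit Arguments.
Unset Strict Implicit.
Context {C : inverse_category}.
Implicit Types X Y Z : C.

Lemma cinvKl X Y (s : hom X Y) : s ∘ cinv s ∘ s = s.
Proof. by case: (cinvP s). Qed.

Lemma cinvKr X Y (s : hom X Y) : cinv s ∘ s ∘ cinv s = cinv s.
Proof. by case: (cinvP s). Qed.

Lemma cinvK X Y (s : hom X Y) : cinv (cinv s) = s.
Proof. by apply/esym/cinv_uniq; split; [apply: cinvKr | apply: cinvKl]. Qed.

Lemma idem_id_arr X Y (s : hom X Y) : idempotent_endo (cinv s ∘ s).
Proof. by rewrite /idempotent_endo ccompA cinvKr. Qed.

Lemma idem_ir_arr X Y (s : hom X Y) : idempotent_endo (s ∘ cinv s).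
Proof. by rewrite /idempotent_endo ccompA cinvKl. Qed.

(** The arrow [f (e f)° e] is idempotent and inverse to [e f].  By uniqueness
    it is [(e f)°], and an idempotent is its own inverse, so [e f] is itself
    idempotent. *)
Lemma idem_comp X (e f : hom X X) :
  idempotent_endo e -> idempotent_endo f -> idempotent_endo (e ∘ f).
Proof.
move=> ee ff; set w := e ∘ f; set g := f ∘ cinv w ∘ e.
have wfe : cinv w ∘ e ∘ f ∘ cinv w = cinv w.
  by rewrite -(ccompA _ e f); apply: cinvKr w.
have ewf : e ∘ f ∘ cinv w ∘ e ∘ f = e ∘ f.
  by rewrite -(ccompA _ e f); apply: cinvKl w.
have gg : idempotent_endo g.
  by rewrite /idempotent_endo /g !ccompA -3!(ccompA f) wfe ccompA.
have wg : inverse_pair w g.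
  split; rewrite /g !ccompA.
    by rewrite -(ccompA e f f) ff -(ccompA _ e e) ee.
  rewrite -(ccompA _ e e) ee -(ccompA _ f f) ff.
  by rewrite -3!(ccompA f) wfe ccompA.
by rewrite -(cinvK w) -(cinv_uniq wg) cinv_idem.
Qed.

(** As [e f] and [f e] are both idempotent, [f e] is inverse to [e f]; but so
    is [e f]. *)
Lemma idem_comm X (e f : hom X X) :
  idempotent_endo e -> idempotent_endo f -> e ∘ f = f ∘ e.
Proof.
move=> ee ff; have efef := idem_comp ee ff.
have fefe := idem_comp ff ee.
rewrite -[LHS](cinv_idem efef); apply/esym/cinv_uniq.
split; rewrite !ccompA.
  by rewrite -(ccompA e f f) ff -(ccompA _ e e) ee -ccompA efef.
by rewrite -(ccompA f e e) ee -(ccompA _ f f) ff -ccompA fefe.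
Qed.

Lemma cinvM X Y Z (s : hom Y Z) (t : hom X Y) :
  cinv (s ∘ t) = cinv t ∘ cinv s.
Proof.
have comm := idem_comm (idem_id_arr s) (idem_ir_arr t).
apply/esym/cinv_uniq; split.
  transitivity (s ∘ ((t ∘ cinv t) ∘ (cinv s ∘ s)) ∘ t); first by rewrite !ccompA.
  by rewrite -comm !ccompA cinvKl -2!(ccompA s) cinvKl.
transitivity (cinv t ∘ ((cinv s ∘ s) ∘ (t ∘ cinv t)) ∘ cinv s).
  by rewrite !ccompA.
by rewrite comm !ccompA cinvKr -2!(ccompA (cinv t)) cinvKr.
Qed.

Lemma cinv_restr X Y (s : hom X Y) (e : hom X X) :
  idempotent_endo e -> cinv (s ∘ e) = e ∘ cinv s.
Proof. by move=> ee; rewrite cinvM cinv_idem. Qed.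

(** Read with [e = iρ(x)], for which [iρ(θ_t(x)) = t e t°]: [x] is in the
    domain of [θ_{s t}] iff it is in that of [θ_t] and [θ_t(x)] is in that of
    [θ_s]. *)
Lemma id_arr_comp_absorb X Y Z (s : hom Y Z) (t : hom X Y) (e : hom X X) :
  idempotent_endo e ->
  cinv (s ∘ t) ∘ (s ∘ t) ∘ e = e <->
  cinv t ∘ t ∘ e = e /\
  cinv s ∘ s ∘ (t ∘ e ∘ cinv t) = t ∘ e ∘ cinv t.
Proof.
move=> ee; rewrite cinvM !ccompA; split=> [ste | [te se]].
  split; first by rewrite -{1}ste !ccompA cinvKr.
  have comm := idem_comm (idem_id_arr s) (idem_ir_arr t).
  transitivity ((cinv s ∘ s) ∘ (t ∘ cinv t) ∘ (cinv s ∘ s) ∘ t ∘ e ∘ cinv t).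
    by rewrite -{1}ste !ccompA.
  rewrite comm -(ccompA (t ∘ cinv t)) idem_id_arr.
  by rewrite -{2}ste !ccompA.
(* [e] commutes with [t°t], so that [t e = (t e t°) t]. *)
have et : e ∘ cinv t ∘ t = e.
  by rewrite -ccompA (idem_comm ee (idem_id_arr t)).
rewrite -{1}et !ccompA.
transitivity (cinv t ∘ (cinv s ∘ s ∘ t ∘ e ∘ cinv t) ∘ t).
  by rewrite !ccompA.
by rewrite se !ccompA te.
Qed.

(** Objects form an arbitrary type, so injectivity of this dependent
    constructor rests on the uniqueness of proofs of equality of objects. *)
Lemma Arrow_inj X Y : injective (@Arrow C X Y).
Proof.
move=> s t st.
pose tr (a : arrow C) (p : src a = X) (q : tgt a = Y) : hom X Y :=
  ecast V (hom X V) q (ecast U (hom U (tgt a)) p (arr a)).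
have : exists p q, tr (Arrow t) p q = s.
  by rewrite -st; exists erefl, erefl.
case=> p [q <-].
by rewrite (Prop_irrelevance p erefl) (Prop_irrelevance q erefl).
Qed.

Lemma arrow_le_comp (a b : arrow C) : arrow_le a b ->
  exists f : hom (src b) (src b), a = Arrow (arr b ∘ f).
Proof. by move=> [X [Y [s [t [[f _ ->] -> ->]]]]]; exists f. Qed.

End InverseCategory.

(** * Domains and values of the action maps *)

Section FibredAction.
Set Implicit Arguments.
Unset Strict Implicit.
Context {C : inverse_category} {d : Order.disp_t} {P : porderType d}.
Variable A : fibred_action C P.
Implicit Types X Y Z : C.

Lemma moment_idem_arr X (e : hom X X) x :
  (moment A x).2 = Arrow e -> idempotent_endo e.
Proof.
move=> xe; have [X0 [f [ff xf]]] := moment_idem A x.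
have eqX : X0 = X by rewrite -[LHS]/(src (Arrow f)) -xf xe.
by case: _ / eqX in e xe *; move: xe; rewrite xf => /Arrow_inj <-.
Qed.

Lemma moment_arr X x : (moment A x).1 = X ->
  exists e : hom X X, (moment A x).2 = Arrow e.
Proof.
move=> <-; have [X0 [f [_ xf]]] := moment_idem A x.
by rewrite -moment_src xf; exists f.
Qed.

Lemma act_domP X Y (s : hom X Y) x :
  act_dom (moment A) (Arrow s) x <->
  exists2 e : hom X X, (moment A x).2 = Arrow e & cinv s ∘ s ∘ e = e.
Proof.
split=> [[/= xX le_x] | [e xe se]].
  have [f xf] := arrow_le_comp le_x.
  by exists (cinv s ∘ s ∘ f); rewrite // ccompA idem_id_arr.
split; first by rewrite -moment_src xe.
rewrite xe; exists X, X, e, (cinv s ∘ s); split=> //.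
by exists e; [apply: moment_idem_arr xe | rewrite se].
Qed.

Lemma act_dom_down X Y (s : hom X Y) x y : x <= y ->
  act_dom (moment A) (Arrow s) y -> act_dom (moment A) (Arrow s) x.
Proof.
move=> /(moment_homo A)/arrow_le_comp[f xf] /act_domP[e ye se].
rewrite {}ye /= in f xf.
by apply/act_domP; exists (e ∘ f); rewrite // ccompA se.
Qed.

(** The membership proof that [action_map] takes depends on the arrow and on
    the point, so neither can be rewritten in place; this congruence is used
    instead. *)
Lemma eq_action_map (a b : arrow C) x y
    (ha : act_dom (moment A) a x) (hb : act_dom (moment A) b y) :
  a = b -> x = y -> action_map A ha = action_map A hb.
Proof.
move=> eqa eqx; case: _ / eqa in hb *; case: _ / eqx in hb *.
by rewrite (Prop_irrelevance ha hb).
Qed.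

Lemma action_map_moment X (e : hom X X) x
    (h : act_dom (moment A) (Arrow e) x) :
  (moment A x).2 = Arrow e -> action_map A h = x.
Proof.
move=> xe; rewrite -[RHS](action_id (act_dom_moment A x)).
exact: eq_action_map.
Qed.

(** Axiom (III) for [x = θ_e(x)]. *)
Lemma action_map_restr X Y (s : hom X Y) (e : hom X X) x
    (h : act_dom (moment A) (Arrow s) x)
    (he : act_dom (moment A) (Arrow (s ∘ e)) x) :
  (moment A x).2 = Arrow e -> action_map A h = action_map A he.
Proof.
move=> xe.
have hx : act_dom (moment A) (Arrow e) x.
  by rewrite -xe; apply: act_dom_moment.
have ex := action_map_moment hx xe.
have hs : act_dom (moment A) (Arrow s) (action_map A hx) by rewrite ex.
by rewrite -(action_comp hs he); apply: eq_action_map.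
Qed.

(** The axioms only bound [iρ(θ_s(x))] in general; replacing [s] by [s e],
    whose initial idempotent is exactly [iρ(x)], turns the bound into an
    equality. *)
Lemma moment_action_map X Y (s : hom X Y) (e : hom X X) x
    (h : act_dom (moment A) (Arrow s) x) :
  (moment A x).2 = Arrow e ->
  (moment A (action_map A h)).2 = Arrow (s ∘ e ∘ cinv s).
Proof.
move=> xe; have ee := moment_idem_arr xe.
have se : cinv s ∘ s ∘ e = e.
  by have [f] := (act_domP s x).1 h; rewrite xe => /Arrow_inj <-.
have id_se : cinv (s ∘ e) ∘ (s ∘ e) = e.
  by rewrite cinv_restr // !ccompA -2!(ccompA e) se ee.
have he : act_dom (moment A) (Arrow (s ∘ e)) x.
  by apply/act_domP; exists e; rewrite // id_se ee.
rewrite (action_map_restr h he xe).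
have [_ _ ->] := action_moment he; last by rewrite xe /id_arr /= id_se.
by rewrite /ir_arr /= cinv_restr // !ccompA -(ccompA s e e) ee.
Qed.

Lemma action_map_idem X (g : hom X X) x
    (h : act_dom (moment A) (Arrow g) x) :
  idempotent_endo g -> action_map A h = x.
Proof.
move=> gg; have [e xe] := (act_domP g x).1 h.
rewrite cinv_idem // gg => ge.
have he : act_dom (moment A) (Arrow (g ∘ e)) x.
  by rewrite ge -xe; apply: act_dom_moment.
rewrite (action_map_restr h he xe).
by apply: action_map_moment; rewrite ge.
Qed.

Lemma act_dom_cinv X Y (s : hom X Y) x
    (h : act_dom (moment A) (Arrow s) x) :
  act_dom (moment A) (Arrow (cinv s)) (action_map A h).
Proof.
have [oy le_y _] := action_moment h; split=> //.
by rewrite /id_arr /= cinvK.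
Qed.

Lemma action_map_cinvK X Y (s : hom X Y) x
    (h : act_dom (moment A) (Arrow s) x)
    (h' : act_dom (moment A) (Arrow (cinv s)) (action_map A h)) :
  action_map A h' = x.
Proof.
have hss : act_dom (moment A) (Arrow (cinv s ∘ s)) x.
  have [e xe se] := (act_domP s x).1 h.
  apply/act_domP; exists e => //.
  by rewrite cinv_idem ?idem_id_arr //; apply: idem_id_arr.
by rewrite (action_comp h' hss) action_map_idem //; apply: idem_id_arr.
Qed.

(** As [s°° = s], each [y] in the domain of [θ_{s°}] equals
    [θ_s(θ_{s°}(y))]. *)
Lemma act_dom_cinvP X Y (s : hom X Y) y :
  act_dom (moment A) (Arrow (cinv s)) y <->
  exists x (h : act_dom (moment A) (Arrow s) x), action_map A h = y.
Proof.
split=> [hy | [x [h <-]]]; last exact: act_dom_cinv.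
have hx := act_dom_cinv hy.
have hx' : act_dom (moment A) (Arrow s) (action_map A hy).
  by move: hx; rewrite cinvK.
exists (action_map A hy), hx'; rewrite -[RHS](action_map_cinvK hx).
by apply: eq_action_map; rewrite ?cinvK.
Qed.

Lemma act_dom_comp X Y Z (s : hom Y Z) (t : hom X Y) x :
  act_dom (moment A) (Arrow (s ∘ t)) x <->
  exists h : act_dom (moment A) (Arrow t) x,
    act_dom (moment A) (Arrow s) (action_map A h).
Proof.
split=> [/act_domP[e xe] | [h]].
  rewrite id_arr_comp_absorb; last exact: moment_idem_arr xe.
  move=> [te se]; have h : act_dom (moment A) (Arrow t) x.
    by apply/act_domP; exists e.
  exists h; apply/act_domP; exists (t ∘ e ∘ cinv t) => //.
  exact: moment_action_map.
have [e xe te] := (act_domP t x).1 h.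
case/act_domP=> f; rewrite (moment_action_map h xe) => /Arrow_inj <-.
move=> se; apply/act_domP; exists e => //.
by apply/id_arr_comp_absorb; first exact: moment_idem_arr xe.
Qed.

Lemma action_map_mono X Y (s : hom X Y) x y
    (hx : act_dom (moment A) (Arrow s) x)
    (hy : act_dom (moment A) (Arrow s) y) :
  (x <= y) = (action_map A hx <= action_map A hy).
Proof.
apply/idP/idP => [|le_xy]; first exact: action_homo.
have := action_homo (act_dom_cinv hx) (act_dom_cinv hy) le_xy.
by rewrite !action_map_cinvK.
Qed.

Lemma action_map_inj X Y (s : hom X Y) x y
    (hx : act_dom (moment A) (Arrow s) x)
    (hy : act_dom (moment A) (Arrow s) y) :
  action_map A hx = action_map A hy -> x = y.
Proof.
move=> eq_xy; rewrite -(action_map_cinvK (act_dom_cinv hx)).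
rewrite -[RHS](action_map_cinvK (act_dom_cinv hy)).
exact: eq_action_map.
Qed.

(** * The functor into partial symmetries *)

Lemma is_ideal_fibre X : is_ideal [set x | (moment A x).1 = X].
Proof.
move=> x y /(moment_homo A)/arrow_le_comp[f xf] /= <-.
by rewrite -!moment_src xf.
Qed.

Definition fibre X : ideal P := Ideal (@is_ideal_fibre X).

Definition act_pfun X Y (s : hom X Y) (x : P) : option P :=
  if pselect (act_dom (moment A) (Arrow s) x) is left h
  then Some (action_map A h) else None.

Lemma act_pfunE X Y (s : hom X Y) x y :
  act_pfun s x = Some y <->
  exists h : act_dom (moment A) (Arrow s) x, action_map A h = y.
Proof.
rewrite /act_pfun; case: pselect => [h | nh].
  split=> [[<-] | [h' <-]]; first by exists h.
  by rewrite (Prop_irrelevance h h').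
by split=> // -[].
Qed.

Lemma pdom_act_pfun X Y (s : hom X Y) :
  pdom (act_pfun s) = act_dom (moment A) (Arrow s).
Proof.
apply/seteqP; split=> x /=; first by move=> [y /act_pfunE[]].
by move=> h; exists (action_map A h); apply/act_pfunE; exists h.
Qed.

Lemma pimg_act_pfun X Y (s : hom X Y) :
  pimg (act_pfun s) = act_dom (moment A) (Arrow (cinv s)).
Proof.
apply/seteqP; split=> y /=.
  by move=> [x /act_pfunE xy]; apply/act_dom_cinvP; exists x.
by move=> /act_dom_cinvP[x xy]; exists x; apply/act_pfunE.
Qed.

Definition act_psym X Y (s : hom X Y) : psym (fibre X) (fibre Y).
Proof.
apply: (@PSym _ _ (fibre X) (fibre Y) (act_pfun s)).
- by rewrite pdom_act_pfun => x y; apply: act_dom_down.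
- by rewrite pdom_act_pfun => x [].
- by rewrite pimg_act_pfun => x y; apply: act_dom_down.
- by rewrite pimg_act_pfun => x [].
- move=> x x' y /act_pfunE[h xy] /act_pfunE[h' x'y].
  by apply: (action_map_inj (hx := h) (hy := h')); rewrite xy.
- by move=> x x' y y' /act_pfunE[h <-] /act_pfunE[h' <-]; apply: action_map_mono.
Defined.

Lemma eq_pfun (f g : P -> option P) :
  (forall x y, f x = Some y <-> g x = Some y) -> f = g.
Proof.
move=> fg; apply/funext => x; case fx: (f x) => [y|].
  by apply/esym/fg.
by case gx: (g x) => [y|] //; move/fg: gx; rewrite fx.
Qed.

Lemma act_psym1 X : act_psym (idc X) = psym1 (fibre X).
Proof.
have id1 : idempotent_endo (idc X) by apply: ccomp1s.
apply/psymP/eq_pfun => x y; rewrite psym1_funE act_pfunE.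
split=> [[h <-] | [xX <-]].
  by rewrite action_map_idem //; split=> //; case: h.
have h : act_dom (moment A) (Arrow (idc X)) x.
  have [e xe] := moment_arr xX.
  by apply/act_domP; exists e; rewrite // cinv_idem // !ccomp1s.
by exists h; apply: action_map_idem.
Qed.

Lemma act_psymM X Y Z (s : hom Y Z) (t : hom X Y) :
  act_psym (s ∘ t) = psym_comp (act_psym s) (act_psym t).
Proof.
apply/psymP/eq_pfun => x z; rewrite pcomp_funE act_pfunE.
split=> [[hst <-] | [y /act_pfunE[ht <-] /act_pfunE[hs <-]]].
  have [ht hs] := (act_dom_comp s t x).1 hst.
  exists (action_map A ht); apply/act_pfunE; first by exists ht.
  by exists hs; apply: action_comp.
have hst : act_dom (moment A) (Arrow (s ∘ t)) x.
  by apply/act_dom_comp; exists ht.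
by exists hst; rewrite (action_comp hs hst).
Qed.

Definition act_functor : functor C (Iic P) :=
  @Functor C (Iic P) fibre (@act_psym) act_psym1 act_psymM.

Lemma fibre_cover : \bigcup_(X in setT) (act_functor X : set P) = setT.
Proof. by apply/seteqP; split=> // x _; exists (moment A x).1. Qed.

Definition act_symmetries : sym_action C P := SymAction fibre_cover.

End FibredAction.

Theorem lemma3p9 (C : inverse_category) (d : Order.disp_t) (P : porderType d)
    (A : fibred_action C P) :
  exists Theta : sym_action C P, determines A Theta.
Proof.
by exists (act_symmetries A); split=> // X Y s x y; apply: act_pfunE.
Qed.
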